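(* Let $q=3^{2m+1}$. Then $q^3-27\leqslant\mathrm{Cr}_{q^3+1}(\mathrm{Ree}(q))\leqslant q^3-1$. Moreover, for the field automorphism $h$ defined below, $d_{q^3+1}(h,\mathrm{Ree}(q))=q^3-27$.
   Context: For $n\geqslant 2$, the Hamming distance on the symmetric group $\mathrm{S}_n$ is $d_n(g,h)=n-|\mathrm{fix}(gh^{-1})|$, where $\mathrm{fix}(x)$ is the set of fixed points of $x$. For a subset $C\subseteq \mathrm{S}_n$ and $v\in\mathrm{S}_n$, $d_n(v,C)=\min\{d_n(v,c)\mid c\in C\}$, and the covering radius of $C$ is $\mathrm{Cr}_n(C)=\max\{d_n(v,C)\mid v\in\mathrm{S}_n\}$. Let $q=3^{2m+1}$, $\ell=3^{m+1}$, and $\Omega=\{(a,b,c,\lambda_1(a,b,c),\lambda_2(a,b,c),\lambda_3(a,b,c))\mid(a,b,c)\in\mathbb{F}_q^3\}\cup\{\infty\}$, where $\lambda_1(a,b,c)=a^2b-ac+b^\ell-a^{\ell+3}$, $\lambda_2(a,b,c)=a^\ell b^\ell-c^\ell+ab^2+bc-a^{2\ell+3}$, $\lambda_3(a,b,c)=ac^\ell-a^{\ell+1}b^\ell+a^{\ell+3}b+a^2b^2-b^{\ell+1}-c^2+a^{2\ell+4}$; so $|\Omega|=q^3+1$, and the Ree group $\mathrm{Ree}(q)$ acts $2$-transitively on $\Omega$. The permutation $h$ of $\Omega$ is defined by $\infty^h=\infty$ and $(a,b,c,\lambda_1(a,b,c),\lambda_2(a,b,c),\lambda_3(a,b,c))^h=(a^3,b^3,c^3,\lambda_1(a^3,b^3,c^3),\lambda_2(a^3,b^3,c^3),\lambda_3(a^3,b^3,c^3))$.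 *)

(* Defs.v *)
From Stdlib Require Import ZArith Ring.
From mathcomp Require Import all_boot all_order all_algebra all_fingroup.
From mathcomp Require Import finfield.

Set Implicit Arguments.
Unset Strict Implicit.
Unset Printing Implicit Defensive.

Import GRing.Theory.
Import GroupScope.

Section Hamming.

Variable T : finType.

Definition hamming_dist (g h : {perm T}) : nat :=
  #|T| - #|'Fix_'P[g * h^-1]|.

(* The default value #|T| bounds every distance, so it only matters for the
   empty set. *)
Definition hamming_dist_set (v : {perm T}) (C : {set {perm T}}) : nat :=
  \big[minn/#|T|]_(c in C) hamming_dist v c.

Definition covering_radius (C : {set {perm T}}) : nat :=
  \max_(v : {perm T}) hamming_dist_set v C.

End Hamming.

Section ReePoints.

Local Open Scope ring_scope.

Variables (m : nat) (F : finFieldType).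

Local Notation l := (3 ^ m.+1)%N.

Definition ree_lambda1 (a b c : F) : F :=
  a ^+ 2 * b - a * c + b ^+ l - a ^+ (l + 3).

Definition ree_lambda2 (a b c : F) : F :=
  a ^+ l * b ^+ l - c ^+ l + a * b ^+ 2 + b * c - a ^+ (2 * l + 3).

Definition ree_lambda3 (a b c : F) : F :=
  a * c ^+ l - a ^+ (l + 1) * b ^+ l + a ^+ (l + 3) * b + a ^+ 2 * b ^+ 2
    - b ^+ (l + 1) - c ^+ 2 + a ^+ (2 * l + 4).

Definition ree_coords (a b c : F) : F * F * F * F * F * F :=
  (a, b, c, ree_lambda1 a b c, ree_lambda2 a b c, ree_lambda3 a b c).

(* None is the point at infinity. *)
Definition ree_Omega : {set option (F * F * F * F * F * F)} :=
  None |: [set Some (ree_coords x.1.1 x.1.2 x.2) | x : F * F * F].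

Definition ree_point := {p : option (F * F * F * F * F * F) | p \in ree_Omega}.

Lemma infty_subproof : None \in ree_Omega.
Proof. exact: setU11. Qed.

Lemma affine_subproof a b c : Some (ree_coords a b c) \in ree_Omega.
Proof. by rewrite !inE; apply/imsetP; exists (a, b, c). Qed.

Definition ree_infty : ree_point := Sub None infty_subproof.

Definition ree_affine (a b c : F) : ree_point :=
  Sub (Some (ree_coords a b c)) (affine_subproof a b c).

Lemma ree_pointP (P : ree_point -> Prop) :
  P ree_infty -> (forall a b c, P (ree_affine a b c)) -> forall p, P p.
Proof.
move=> Pi Pa [p pO]; have := pO; rewrite !inE => /orP[/eqP p0|].
  by suff -> : exist _ p pO = ree_infty by []; apply: val_inj.
case/imsetP=> -[[a b] c] _ pE.
by suff -> : exist _ p pO = ree_affine a b c by []; apply: val_inj.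
Qed.

Lemma ree_affine_inj a b c a' b' c' :
  ree_affine a b c = ree_affine a' b' c' -> [/\ a = a', b = b' & c = c'].
Proof. by move/(congr1 val) => /= -[-> -> ->]. Qed.

Lemma card_ree_point : #|{: ree_point}| = (#|F| ^ 3 + 1)%N.
Proof.
rewrite card_sig cardsU1 card_imset; last first.
  by move=> [[a b] c] [[a' b'] c'] /= [-> -> ->].
rewrite (_ : None \notin _) ?addn1 ?add1n; last by apply/imsetP => -[].
by rewrite !card_prod -mulnA.
Qed.

(* ree_t_fun, ree_n_fun and ree_w_fun are the generators of the Ree group given
   in Dixon and Mortimer, Permutation Groups, Section 7.7. Only the images of
   the first three coordinates are written: they determine the point. *)
Definition ree_t_fun (al be ga : F) (p : ree_point) : ree_point :=
  if val p is Some (a, b, c, _, _, _) then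
    ree_affine (a + al) (b + be + al ^+ l * a)
      (c + ga - al * b + be * a - al ^+ (l + 1) * a)
  else ree_infty.

Definition ree_n_fun (k : F) (p : ree_point) : ree_point :=
  if val p is Some (a, b, c, _, _, _) then
    ree_affine (k * a) (k ^+ (l + 1) * b) (k ^+ (l + 2) * c)
  else ree_infty.

Definition ree_w_fun (p : ree_point) : ree_point :=
  if val p is Some (a, b, c, l1, l2, l3) then
    if [&& a == 0, b == 0 & c == 0] then ree_infty
    else ree_affine (l2 / l3) (l1 / l3) (c / l3)
  else ree_affine 0 0 0.

Definition ree_h_fun (p : ree_point) : ree_point :=
  if val p is Some (a, b, c, _, _, _) then
    ree_affine (a ^+ 3) (b ^+ 3) (c ^+ 3)
  else ree_infty.

Lemma ree_t_inj al be ga : injective (ree_t_fun al be ga).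
Proof.
elim/ree_pointP=> [|a b c]; elim/ree_pointP=> [|a' b' c'] //.
rewrite /ree_t_fun /= => /ree_affine_inj[/addIr -> /addIr/addIr ->].
by move=> /addIr/addIr/addIr/addIr ->.
Qed.

Lemma ree_n_inj k : k != 0 -> injective (ree_n_fun k).
Proof.
move=> k0; elim/ree_pointP=> [|a b c]; elim/ree_pointP=> [|a' b' c'] //.
rewrite /ree_n_fun /= => /ree_affine_inj[/(mulfI k0) ->].
by move=> /(mulfI (expf_neq0 _ k0)) -> /(mulfI (expf_neq0 _ k0)) ->.
Qed.

End ReePoints.

Section ReeFacts.

Local Open Scope ring_scope.

Variables (m : nat) (F : finFieldType).
Hypothesis cardF : #|F| = (3 ^ (2 * m + 1))%N.

Local Notation l := (3 ^ m.+1)%N.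

Lemma ree_pchar : 3%N \in [pchar F].
Proof. exact: (card_finPcharP cardF). Qed.

Let three0 : 1 + 1 + 1 = 0 :> F.
Proof. by rewrite -[RHS](pcharf0 ree_pchar) -addrA. Qed.

(* Registers F with the ring tactic, with coefficients normalized in Z/3. *)
Inductive tern := Tz | To | Tm.

Let tadd x y := match x, y with
  | Tz, z => z | z, Tz => z | To, To => Tm | Tm, Tm => To | _, _ => Tz end.
Let topp x := match x with Tz => Tz | To => Tm | Tm => To end.
Let tmul x y := match x, y with
  | Tz, _ => Tz | _, Tz => Tz | To, z => z | Tm, z => topp z end.
Let tsub x y := tadd x (topp y).
Let teqb x y := match x, y with
  | Tz, Tz => true | To, To => true | Tm, Tm => true | _, _ => false end.

Let fadd (x y : F) : F := x + y.
Let fmul (x y : F) : F := x * y.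
Let fsub (x y : F) : F := x - y.
Let fopp (x : F) : F := - x.
Let fexp (x : F) n : F := x ^+ n.
Let fzero : F := 0.
Let fone : F := 1.

Let tphi x : F := match x with Tz => fzero | To => fone | Tm => fopp fone end.

Let F_ring : ring_theory fzero fone fadd fmul fsub fopp (@eq F).
Proof.
split=> //; [exact: add0r | exact: addrC | exact: addrA | exact: mul1r
  | exact: mulrC | exact: mulrA | exact: mulrDl | exact: subrr].
Qed.

Let tphi_morph : ring_morph fzero fone fadd fmul fsub fopp (@eq F)
  Tz To tadd tmul tsub topp teqb tphi.
Proof.
have E2 : 1 + 1 = -1 :> F by apply/eqP; rewrite -subr_eq0 opprK three0.
have E3 : -1 - 1 = 1 :> F by rewrite -opprD E2 opprK.
by rewrite /fzero /fone /fadd /fmul /fsub /fopp; split=> //=; [move=> [] [] | move=> [] [] | move=> [] [] | move=> []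
  | move=> [] []] => //=;
  rewrite ?add0r ?addr0 ?mul0r ?mulr0 ?mul1r ?mulr1 ?mulrNN ?mul1r ?opprK ?oppr0
    ?subr0 ?sub0r ?addr0 ?subrr ?addNr ?E2 ?E3.
Qed.

Let F_pow : power_theory fone fmul (@eq F) N.to_nat fexp.
Proof.
split=> x [|p] //=; rewrite /fexp.
elim/Pos.peano_ind: p => [|p IHp]; first by rewrite expr1.
rewrite Pos2Nat.inj_succ exprS IHp; symmetry.
apply: (@pow_pos_succ _ fmul eq) => //; try exact: mulrA.
Qed.

Local Ltac tern_cst t := match t with
  | fzero => constr:(Tz)
  | fone => constr:(To)
  | _ => constr:(InitialRing.NotConstant) end.
Local Ltac natexp_cst t :=
  match isnatcst t with
  | true => constr:(N.of_nat t)
  | _ => constr:(InitialRing.NotConstant)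
  end.

Add Ring F_ring_tern : F_ring
  (morphism tphi_morph, constants [tern_cst], power_tac F_pow [natexp_cst]).

Let faddE x y : x + y = fadd x y. Proof. by []. Qed.
Let fmulE x y : x * y = fmul x y. Proof. by []. Qed.
Let foppE x : - x = fopp x. Proof. by []. Qed.
Let fexpE x n : x ^+ n = fexp x n. Proof. by []. Qed.
Let fzeroE : 0 = fzero. Proof. by []. Qed.
Let foneE : 1 = fone. Proof. by []. Qed.

Local Ltac ring3 :=
  rewrite ?faddE ?fmulE ?foppE ?fexpE ?fzeroE ?foneE;
  match goal with |- @eq _ ?a ?b => change (@eq F a b) end; ring.

Let s (x : F) : F := x ^+ l.

Let sD (x y : F) : s (x + y) = s x + s y.
Proof. by rewrite /s exprDn_pchar ?pnatX ?(pnatE _ (isT : prime 3)) ?ree_pchar. Qed.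
Let sM (x y : F) : s (x * y) = s x * s y. Proof. exact: exprMn. Qed.
Let sN (x : F) : s (- x) = - s x.
Proof. by apply/eqP; rewrite -addr_eq0 -sD addNr /s expr0n expn_eq0. Qed.
Let s0 : s 0 = 0. Proof. by rewrite /s expr0n expn_eq0. Qed.
Let s1 : s 1 = 1. Proof. exact: expr1n. Qed.
Let sX (x : F) n : s (x ^+ n) = s x ^+ n. Proof. exact: exprAC. Qed.
Let ss (x : F) : s (s x) = x ^+ 3.
Proof.
rewrite /s -exprM (_ : l * l = 3 ^ (2 * m + 1) * 3)%N.
  by rewrite exprM -cardF expf_card.
by rewrite -expnD -expnSr addSn addnS addnn -mul2n addn1.
Qed.
Let sI : injective s.
Proof.
move=> x y /eqP; rewrite -subr_eq0 -sN -sD expf_eq0 => /andP[_].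
by rewrite subr_eq0 => /eqP.
Qed.
Let cubeI : injective (fun x : F => x ^+ 3).
Proof. by move=> x y /=; rewrite -!ss => /sI/sI. Qed.

Let lam1E (a b c : F) : ree_lambda1 m a b c = a ^+ 2 * b - a * c + s b - s a * a ^+ 3.
Proof. by rewrite /ree_lambda1 (exprD a l 3). Qed.
Let lam2E (a b c : F) : ree_lambda2 m a b c =
  s a * s b - s c + a * b ^+ 2 + b * c - s a ^+ 2 * a ^+ 3.
Proof. by rewrite /ree_lambda2 (exprD a (2 * l) 3) (mulnC 2 l) (exprM a l 2). Qed.
Let lam3E (a b c : F) : ree_lambda3 m a b c =
  a * s c - s a * a * s b + s a * a ^+ 3 * b + a ^+ 2 * b ^+ 2
  - s b * b - c ^+ 2 + s a ^+ 2 * a ^+ 4.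
Proof.
rewrite /ree_lambda3 (exprD a l 1) (exprD a l 3) (exprD b l 1).
by rewrite (exprD a (2 * l) 4) (mulnC 2 l) (exprM a l 2) !expr1.
Qed.

Let two_neq0 (x : F) : x = - x -> x = 0.
Proof.
move=> xN; have <- : x + x + x = x by rewrite {1}xN addNr add0r.
by ring3.
Qed.

Let sq_eq (x y : F) : x ^+ 2 = y ^+ 2 -> x = y \/ x = - y.
Proof. by move/eqP; rewrite eqf_sqr => /orP[]/eqP; [left|right]. Qed.

Let aniso0 (b c : F) : s b * b + c ^+ 2 = 0 -> b = 0 /\ c = 0.
Proof.
move=> E; have E' : b ^+ 3 * s b + s c ^+ 2 = 0.
  by rewrite -ss -sX -sM -sD E s0.
have /sq_eq Ec : s c ^+ 2 = (c * b) ^+ 2.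
  apply/eqP; rewrite -subr_eq0; apply/eqP.
  transitivity ((b ^+ 3 * s b + s c ^+ 2) - b ^+ 2 * (s b * b + c ^+ 2)).
    by ring3.
  by rewrite E E' mulr0 subr0.
have c0 : c = 0.
  apply: cubeI; rewrite /= expr0n /=; apply: two_neq0.
  transitivity (c * (s b * b)).
    by case: Ec => Ec; rewrite -ss Ec ?sN sM Ec; ring3.
  rewrite (_ : s b * b = - c ^+ 2); first by ring3.
  by apply/eqP; rewrite -addr_eq0 E.
split=> //; move: E; rewrite c0 expr0n addr0 => /eqP; rewrite mulf_eq0.
by rewrite expf_eq0 => /orP[/andP[_]|] /eqP.
Qed.

Let only_m1 (y : F) : s y - 1 = - y -> y = -1.
Proof.
move=> E; have E1 : s y = 1 - y by rewrite -[s y](subrK 1) E addrC.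
have E2 : y ^+ 3 = y by rewrite -ss E1 sD sN s1 E1; ring3.
have := E2; move/eqP; rewrite -subr_eq0.
have -> : y ^+ 3 - y = y * ((y - 1) * (y + 1)) by ring3.
rewrite !mulf_eq0 => /or3P[/eqP y0|/eqP y1|]; last by rewrite addr_eq0 => /eqP.
  by have := E1; rewrite y0 s0 subr0 => /esym/eqP; rewrite oner_eq0.
have := E1; rewrite (_ : y = 1) ?s1 ?subrr => [/eqP|]; first by rewrite oner_eq0.
by apply/eqP; rewrite -subr_eq0 y1.
Qed.

Let only_m1' (y : F) : s y - 1 = - y ^+ 3 -> y = -1.
Proof.
move=> E; apply: only_m1.
have : s (s y - 1) = s (- y ^+ 3) by rewrite E.
rewrite sD !sN s1 ss sX => E1.
have /cubeI E2 : (y - 1) ^+ 3 = (- s y) ^+ 3.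
  by transitivity (y ^+ 3 - 1); [ring3 | rewrite E1; ring3].
have -> : s y = - (y - 1) by rewrite E2 opprK.
by ring3.
Qed.

Let sm1 : s (-1) = -1. Proof. by rewrite sN s1. Qed.

Let aniso1 (y z : F) :
  s z - s y + y + y ^+ 2 - s y * y - z ^+ 2 + 1 <> 0.
Proof.
set Y := s y; set Z := s z => E.
have eY : s Y = y ^+ 3 by rewrite /Y ss.
have eZ : s Z = z ^+ 3 by rewrite /Z ss.
have YE : s y = Y by [].
have ZE : s z = Z by [].
clearbody Y Z.
have E' : z ^+ 3 - y ^+ 3 + Y + Y ^+ 2 - y ^+ 3 * Y - Z ^+ 2 + 1 = 0.
  by have := congr1 s E; rewrite s0 !(sD, sN, sM, sX, s1) eY eZ YE ZE.
have EZ : Z = Y - y - y ^+ 2 + Y * y + z ^+ 2 - 1.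
  by apply/eqP; rewrite -subr_eq0 -E; apply/eqP; ring3.
have : ((z + y) ^+ 2 + y * (Y - 1)) * ((z - y + 1) ^+ 2 + Y * (y - 1)) = 0.
  by rewrite -[RHS]oppr0 -E' EZ; ring3.
move/eqP; rewrite mulf_eq0 => /orP[]/eqP.
  set r := z + y => Er; set R := Z + Y.
  have sr : s r = R by rewrite /r sD YE ZE.
  have ER : R = - (Y + 1) + r * y.
    apply/eqP; rewrite -subr_eq0 /R EZ; apply/eqP.
    by rewrite -Er /r; ring3.
  have ER2 : R ^+ 2 + Y * (y ^+ 3 - 1) = 0.
    by have := congr1 s Er; rewrite s0 !(sD, sN, sM, sX, s1) ?eY YE ZE.
  have Er2 : r ^+ 2 = - (y * (Y - 1)) by apply/eqP; rewrite -addr_eq0 Er.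
  have ry : r * y * (Y + 1) = - ((Y - 1) ^+ 2 + y ^+ 3).
    apply/eqP; rewrite -subr_eq0 -ER2 ER; apply/eqP.
    have -> : (- (Y + 1) + r * y) ^+ 2 =
      (Y + 1) ^+ 2 + (Y + 1) * r * y + r ^+ 2 * y ^+ 2 by ring3.
    by rewrite Er2; ring3.
  have /eqP : (Y - 1 + y) ^+ 3 * (Y - 1 + y ^+ 3) = 0.
    transitivity ((- ((Y - 1) ^+ 2 + y ^+ 3)) ^+ 2
      - (- (y * (Y - 1))) * y ^+ 2 * (Y + 1) ^+ 2); first by ring3.
    by rewrite -ry -Er2; ring3.
  have ym1 : y = -1 -> False.
    move=> y1; have Y1 : Y = -1 by rewrite -YE y1.
    have R1 : R = - r by rewrite ER y1 Y1; ring3.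
    have /sq_eq : r ^+ 2 = 1 ^+ 2 by rewrite Er2 y1 Y1; ring3.
    case=> r1; have := R1; rewrite -sr r1 ?sm1 ?s1 ?opprK.
      by move=> /two_neq0/eqP; rewrite oner_eq0.
    by move=> /esym/two_neq0/eqP; rewrite oner_eq0.
  rewrite mulf_eq0 expf_eq0 -YE /= => /orP[]; rewrite addr_eq0 => /eqP.
    by move/only_m1/ym1.
  by move/only_m1'/ym1.
set r := z - y + 1 => Er; set R := Z - Y + 1.
have sr : s r = R by rewrite /r !sD sN s1 YE ZE.
have ER : R = Y + 1 - r * (y - 1).
  apply/eqP; rewrite -subr_eq0 /R EZ; apply/eqP.
  by rewrite -Er /r; ring3.
have ER2 : R ^+ 2 + y ^+ 3 * (Y - 1) = 0.
  by have := congr1 s Er; rewrite s0 !(sD, sN, sM, sX, s1) ?eY YE ZE.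
have Er2 : r ^+ 2 = - (Y * (y - 1)) by apply/eqP; rewrite -addr_eq0 Er.
have ry : r * (y - 1) * (Y + 1) = y ^+ 3 - Y ^+ 2 - 1.
  apply/eqP; rewrite -subr_eq0 -ER2 ER; apply/eqP.
  have -> : (Y + 1 - r * (y - 1)) ^+ 2 =
    (Y + 1) ^+ 2 + (Y + 1) * r * (y - 1) + r ^+ 2 * (y - 1) ^+ 2 by ring3.
  by rewrite Er2; ring3.
have /eqP : (Y + y - 1) ^+ 3 * (Y + y ^+ 3 - 1) = 0.
  transitivity ((y ^+ 3 - Y ^+ 2 - 1) ^+ 2
    - (- (Y * (y - 1))) * (y - 1) ^+ 2 * (Y + 1) ^+ 2); first by ring3.
  by rewrite -ry -Er2; ring3.
have ym1 : y = -1 -> False.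
  move=> y1; have Y1 : Y = -1 by rewrite -YE y1.
  have R1 : R = - r by rewrite ER y1 Y1; ring3.
  have /sq_eq : r ^+ 2 = 1 ^+ 2 by rewrite Er2 y1 Y1; ring3.
  case=> r1; have := R1; rewrite -sr r1 ?sm1 ?s1 ?opprK.
    by move=> /two_neq0/eqP; rewrite oner_eq0.
  by move=> /esym/two_neq0/eqP; rewrite oner_eq0.
rewrite mulf_eq0 expf_eq0 -YE /= => /orP[]; rewrite addrAC addr_eq0 => /eqP.
  by move/only_m1/ym1.
by move/only_m1'/ym1.
Qed.

Lemma ree_lambda3_eq0 (a b c : F) :
  (ree_lambda3 m a b c == 0) = [&& a == 0, b == 0 & c == 0].
Proof.
apply/eqP/and3P => [|[/eqP-> /eqP-> /eqP->]]; last first.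
  by rewrite lam3E !s0; ring3.
rewrite lam3E; have [-> E|a0 E] := eqVneq a 0.
  suff [-> ->] : b = 0 /\ c = 0 by rewrite eqxx.
  apply: aniso0; rewrite -[RHS]oppr0 -E; by ring3.
pose y := b / (s a * a); pose z := c / (s a * a ^+ 2).
have A0 : s a != 0 by rewrite expf_neq0.
have bE : b = s a * a * y by rewrite /y mulrC divfK // mulf_neq0.
have cE : c = s a * a ^+ 2 * z by rewrite /z mulrC divfK // mulf_neq0 // expf_neq0.
case: (@aniso1 y z); apply/eqP.
rewrite -(mulrI_eq0 _ (lregP (mulf_neq0 (expf_neq0 2 A0) (expf_neq0 4 a0)))).
apply/eqP; rewrite -[RHS]E bE cE !sM !ss; by ring3.
Qed.

Let w1 (b c L1 L2 L3 M1 M2 M3 u U : F) : L3 * u = 1 -> M3 * U = 1 ->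
  L2 ^+ 2 * L1 * M3 - L2 * c * L3 * M3 + M1 * L3 ^+ 3 - M2 * L2 ^+ 3
    = b * L3 ^+ 2 * M3 ->
  (L2 * u) ^+ 2 * (L1 * u) - (L2 * u) * (c * u) + M1 * U
    - (M2 * U) * (L2 * u) ^+ 3 = b * u.
Proof.
move=> Lu MU E.
transitivity ((M3 * U) * (L2 ^+ 2 * L1 * u ^+ 3)
  - (L3 * u) * (M3 * U) * (L2 * c * u ^+ 2) + (L3 * u) ^+ 3 * (M1 * U)
  - (M2 * U) * (L2 * u) ^+ 3); first by rewrite Lu MU; ring3.
transitivity (u ^+ 3 * U * (b * L3 ^+ 2 * M3)); first by rewrite -E; ring3.
transitivity (b * u * (L3 * u) ^+ 2 * (M3 * U)); first by ring3.
by rewrite Lu MU; ring3.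
Qed.

Let w2 (a c C L1 L2 L3 M1 M2 M3 u U : F) : L3 * u = 1 -> M3 * U = 1 ->
  M2 * M1 * L3 ^+ 3 - C * M3 * L3 ^+ 3 + L2 * L1 ^+ 2 * M3 ^+ 2
    + L1 * c * L3 * M3 ^+ 2 - M2 ^+ 2 * L2 ^+ 3 = a * L3 ^+ 2 * M3 ^+ 2 ->
  (M2 * U) * (M1 * U) - C * U + (L2 * u) * (L1 * u) ^+ 2
    + (L1 * u) * (c * u) - (M2 * U) ^+ 2 * (L2 * u) ^+ 3 = a * u.
Proof.
move=> Lu MU E.
transitivity ((L3 * u) ^+ 3 * (M2 * M1 * U ^+ 2)
  - (L3 * u) ^+ 3 * (M3 * U) * (C * U)
  + (M3 * U) ^+ 2 * ((L2 * u) * (L1 * u) ^+ 2)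
  + (L3 * u) * (M3 * U) ^+ 2 * ((L1 * u) * (c * u))
  - (M2 * U) ^+ 2 * (L2 * u) ^+ 3); first by rewrite Lu MU; ring3.
transitivity (u ^+ 3 * U ^+ 2 * (a * L3 ^+ 2 * M3 ^+ 2)).
  by rewrite -E; ring3.
transitivity (a * u * (L3 * u) ^+ 2 * (M3 * U) ^+ 2); first by ring3.
by rewrite Lu MU; ring3.
Qed.

Let w3 (c C L1 L2 L3 M1 M2 M3 u U : F) : L3 * u = 1 -> M3 * U = 1 ->
  L2 * C * L3 ^+ 3 * M3 - M2 * L2 * M1 * L3 ^+ 3 + M2 * L2 ^+ 3 * L1 * M3
    + L2 ^+ 2 * L1 ^+ 2 * M3 ^+ 2 - M1 * L1 * L3 ^+ 3 * M3
    - c ^+ 2 * L3 ^+ 2 * M3 ^+ 2 + M2 ^+ 2 * L2 ^+ 4 = L3 ^+ 3 * M3 ^+ 2 ->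
  (L2 * u) * (C * U) - (M2 * U) * (L2 * u) * (M1 * U)
    + (M2 * U) * (L2 * u) ^+ 3 * (L1 * u) + (L2 * u) ^+ 2 * (L1 * u) ^+ 2
    - (M1 * U) * (L1 * u) - (c * u) ^+ 2 + (M2 * U) ^+ 2 * (L2 * u) ^+ 4 = u.
Proof.
move=> Lu MU E.
transitivity ((L3 * u) ^+ 3 * (M3 * U) * (L2 * u) * (C * U)
  - (L3 * u) ^+ 3 * (M2 * U) * (L2 * u) * (M1 * U)
  + (M3 * U) * (M2 * U) * (L2 * u) ^+ 3 * (L1 * u)
  + (M3 * U) ^+ 2 * (L2 * u) ^+ 2 * (L1 * u) ^+ 2
  - (L3 * u) ^+ 3 * (M3 * U) * (M1 * U) * (L1 * u)
  - (L3 * u) ^+ 2 * (M3 * U) ^+ 2 * (c * u) ^+ 2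
  + (M2 * U) ^+ 2 * (L2 * u) ^+ 4); first by rewrite Lu MU; ring3.
transitivity (u ^+ 4 * U ^+ 2 * (L3 ^+ 3 * M3 ^+ 2)).
  by rewrite -E; ring3.
transitivity (u * (L3 * u) ^+ 3 * (M3 * U) ^+ 2); first by ring3.
by rewrite Lu MU; ring3.
Qed.

(* The six coordinates of the image of an affine point under ree_w_fun. *)
Lemma ree_w_coords (a b c : F) (l1 := ree_lambda1 m a b c)
    (l2 := ree_lambda2 m a b c) (l3 := ree_lambda3 m a b c) : l3 != 0 ->
  ree_coords m (l2 / l3) (l1 / l3) (c / l3)
    = (l2 / l3, l1 / l3, c / l3, b / l3, a / l3, 1 / l3).
Proof.
move=> l30; have l3u : l3 * l3^-1 = 1 by rewrite divff.
move: (l3^-1) l3u => u l3u.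
have M3U : s l3 * s u = 1 by rewrite -sM l3u s1.
have M1E : s l1 = s a ^+ 2 * s b - s a * s c + b ^+ 3 - a ^+ 3 * s a ^+ 3.
  by rewrite /l1 lam1E !(sD, sN, sM) !ss; ring3.
have M2E : s l2 = a ^+ 3 * b ^+ 3 - c ^+ 3 + s a * s b ^+ 2 + s b * s c
    - (a ^+ 3) ^+ 2 * s a ^+ 3.
  by rewrite /l2 lam2E !(sD, sN, sM) !ss; ring3.
have M3E : s l3 = s a * c ^+ 3 - a ^+ 3 * s a * b ^+ 3
    + a ^+ 3 * s a ^+ 3 * s b + s a ^+ 2 * s b ^+ 2 - b ^+ 3 * s b
    - s c ^+ 2 + (a ^+ 3) ^+ 2 * s a ^+ 4.
  by rewrite /l3 lam3E !(sD, sN, sM) !ss; ring3.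
rewrite /ree_coords lam1E lam2E lam3E !sM mul1r.
have -> := @w1 b c l1 l2 l3 (s l1) (s l2) (s l3) u (s u) l3u M3U.
have -> := @w2 a c (s c) l1 l2 l3 (s l1) (s l2) (s l3) u (s u) l3u M3U.
have -> // := @w3 c (s c) l1 l2 l3 (s l1) (s l2) (s l3) u (s u) l3u M3U.
all: rewrite M1E M2E M3E /l1 /l2 /l3 lam1E lam2E lam3E.
all: move: (s a) (s b) (s c) => A B C; ring3.
Qed.

Lemma ree_w_involutive : involutive (@ree_w_fun m F).
Proof.
elim/ree_pointP=> [|a b c]; first by rewrite /ree_w_fun /= !eqxx.
rewrite {2}/ree_w_fun /=; case: ifP => [/and3P[/eqP-> /eqP-> /eqP->] //|abc].
have l30 : ree_lambda3 m a b c != 0 by rewrite ree_lambda3_eq0 abc.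
have [] := ree_w_coords l30; rewrite /ree_w_fun /= => e1 e2 e3.
rewrite -ree_lambda3_eq0 e1 e2 e3 mulf_eq0 oner_eq0 invr_eq0 (negPf l30) /=.
by rewrite !div1r !invrK !divfK.
Qed.

Lemma ree_h_inj : injective (@ree_h_fun m F).
Proof.
elim/ree_pointP=> [|a b c]; elim/ree_pointP=> [|a' b' c'] //.
by rewrite /ree_h_fun /= => /ree_affine_inj[/cubeI-> /cubeI-> /cubeI->].
Qed.

End ReeFacts.

Section ReeGroup.

Local Open Scope ring_scope.

Variables (m : nat) (F : finFieldType).
Hypothesis cardF : #|F| = (3 ^ (2 * m + 1))%N.

Definition ree_t (al be ga : F) : {perm ree_point m F} :=
  perm (@ree_t_inj m F al be ga).

Lemma unit_neq0_subproof (k : {unit F}) : val k != 0.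
Proof. by rewrite -unitfE (valP k). Qed.

Definition ree_n (k : {unit F}) : {perm ree_point m F} :=
  perm (@ree_n_inj m F (val k) (unit_neq0_subproof k)).

Definition ree_w : {perm ree_point m F} :=
  perm (inv_inj (ree_w_involutive cardF)).

Definition ree_h : {perm ree_point m F} := perm (ree_h_inj cardF).

Definition Ree : {group {perm ree_point m F}} :=
  <<[set ree_t x.1.1 x.1.2 x.2 | x : F * F * F]
    :|: [set ree_n k | k : {unit F}] :|: [set ree_w]>>%G.

End ReeGroup.

(* Main.v *)
Require Import Defs.
From mathcomp Require Import all_boot all_order all_algebra all_fingroup.
From mathcomp Require Import ring.

(** Embed Omega in the quadric [x0 x6 + x1 x5 + x2 x4 + x3^2 = 0] of F^7 by
    [(a, b, c) |-> (1, a, b, c, lambda1, lambda2, lambda3)] and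
    [infty |-> (0, ..., 0, 1)], and let B be the polar form.  It vanishes only
    on equal points of Omega.  Every g in the Ree group is a similitude,
    [B(p^g, r^g) = mu(p) mu(r) B(p, r)], whereas [B(p^h, r^h) = B(p, r)^3].
    Hence [B(p, r)^2 = mu(p) mu(r)] for distinct points p, r where g and h
    agree, so on the agreement set the matrix [B^2] is, up to diagonal scaling,
    [J - I].  Its rank is at most 27, the dimension of the space of quadratic
    forms in 7 variables modulo the equation of the quadric, so g and h agree
    in at most 28 points; for g = 1 these are infty and the 27 points over F_3.
    The upper bound on the covering radius is 2-transitivity. *)

Set Implicit Arguments.
Unset Strict Implicit.
Unset Printing Implicit Defensive.

Import Order.TTheory GRing.Theory.

(** * Rank bound for partial ovoids of the quadric *)

Section PartialOvoid.

Local Open Scope ring_scope.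

Variable F : fieldType.

Implicit Types x y : nat -> F.

Definition quad7 x : F := x 0 * x 6 + x 1 * x 5 + x 2 * x 4 + x 3 ^+ 2.

Definition polar7 x y : F :=
  x 0 * y 6 + x 1 * y 5 + x 2 * y 4 + 2 * (x 3 * y 3)
    + x 4 * y 2 + x 5 * y 1 + x 6 * y 0.

(* The product [x 0 * x 6] is left out: on the quadric it is a combination of
   the others, which accounts for the terms [- y 0 * y 6] in comonomials7. *)
Definition monomials7 x : seq F :=
  [:: x 0 ^+ 2; x 1 ^+ 2; x 2 ^+ 2; x 3 ^+ 2; x 4 ^+ 2; x 5 ^+ 2; x 6 ^+ 2;
      x 0 * x 1; x 0 * x 2; x 0 * x 3; x 0 * x 4; x 0 * x 5;
      x 1 * x 2; x 1 * x 3; x 1 * x 4; x 1 * x 5; x 1 * x 6;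
      x 2 * x 3; x 2 * x 4; x 2 * x 5; x 2 * x 6;
      x 3 * x 4; x 3 * x 5; x 3 * x 6; x 4 * x 5; x 4 * x 6; x 5 * x 6].

Definition comonomials7 y : seq F :=
  [:: y 6 ^+ 2; y 5 ^+ 2; y 4 ^+ 2; 2 * (2 * y 3 ^+ 2 - y 0 * y 6);
      y 2 ^+ 2; y 1 ^+ 2; y 0 ^+ 2;
      2 * (y 6 * y 5); 2 * (y 6 * y 4); 4 * (y 6 * y 3);
      2 * (y 6 * y 2); 2 * (y 6 * y 1);
      2 * (y 5 * y 4); 4 * (y 5 * y 3); 2 * (y 5 * y 2);
      2 * (y 1 * y 5 - y 0 * y 6); 2 * (y 5 * y 0);
      4 * (y 4 * y 3); 2 * (y 2 * y 4 - y 0 * y 6);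
      2 * (y 4 * y 1); 2 * (y 4 * y 0);
      4 * (y 3 * y 2); 4 * (y 3 * y 1); 4 * (y 3 * y 0);
      2 * (y 2 * y 1); 2 * (y 2 * y 0); 2 * (y 1 * y 0)].

Lemma polar7_sq x y : quad7 x = 0 ->
  polar7 x y ^+ 2 =
    \sum_(i < 27) (monomials7 x)`_i * (comonomials7 y)`_i.
Proof.
(* The equation is solved for [x 0 * x 6], so that [ring] can eliminate this product. *)
rewrite /quad7 -!addrA => /eqP; rewrite addr_eq0 => /eqP Qx.
rewrite !big_ord_recl big_ord0 /= /polar7.
by ring: Qx.
Qed.

Lemma card_partial_ovoid (T : finType) (S : {set T}) (v : T -> nat -> F)
    (mu : T -> F) :
  {in S, forall p, quad7 (v p) = 0} -> {in S, forall p, mu p != 0} ->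
  {in S &, forall p r, p != r -> polar7 (v p) (v r) ^+ 2 = mu p * mu r} ->
  (#|S| <= 28)%N.
Proof.
move=> Qv mu0 Bv.
pose e (i : 'I_#|S|) := enum_val i.
have eS i : e i \in S by apply: enum_valP.
pose U := \matrix_(i < #|S|, j < 27)
  ((mu (e i))^-1 * (monomials7 (v (e i)))`_j).
pose V := \matrix_(j < 27, i < #|S|)
  ((comonomials7 (v (e i)))`_j * (mu (e i))^-1).
(* [U *m V] is B^2 with row and column p scaled by [(mu p)^-1]: it is 1 off the diagonal, and 0 on
   it since B(x, x) = 2 Q(x). Comparing ranks gives #|S| <= 1 + 27. *)
have I_eq : 1%:M = const_mx 1 *m (const_mx 1 : 'M_(1, _)) + - U *m V.
  apply/matrixP => i j; rewrite mulNmx !mxE big_ord1 !mxE mulr1.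
  have -> : \sum_k U i k * V k j =
      (mu (e i))^-1 * polar7 (v (e i)) (v (e j)) ^+ 2 * (mu (e j))^-1.
    rewrite polar7_sq ?Qv // mulr_sumr mulr_suml; apply: eq_bigr => k _.
    by rewrite !mxE !mulrA.
  have [<-|ij] := eqVneq i j.
    have -> : polar7 (v (e i)) (v (e i)) = 2 * quad7 (v (e i)).
      by rewrite /polar7 /quad7; ring.
    by rewrite Qv // mulr0 expr0n mulr0 mul0r subr0.
  rewrite Bv //; last by apply: contraNneq ij => /enum_val_inj ->.
  by rewrite mulrA mulVf ?mu0 // mul1r divff ?mu0 // subrr.
rewrite -[leqLHS](@mxrank1 F) I_eq; apply: leq_trans (mxrank_add _ _) _.
exact: (leq_add (mulmx_max_rank _ _) (mulmx_max_rank _ _)).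
Qed.

End PartialOvoid.

(** * Hamming distance through points of agreement *)

Section Hamming.

Variable T : finType.
Implicit Types (g h v : {perm T}) (C : {set {perm T}}).

Lemma hamming_distE g h : hamming_dist g h = #|T| - #|[set x | g x == h x]|.
Proof.
congr (_ - #|pred_of_set _|); apply/setP => x.
rewrite inE; apply/afix1P/eqP; rewrite /= apermE permM.
  by move=> {2}<-; rewrite permKV.
by move=> ->; rewrite permK.
Qed.

Lemma hamming_dist_set_le v C c :
  c \in C -> hamming_dist_set v C <= hamming_dist v c.
Proof. by move=> cC; exact: (@bigmin_le_cond _ nat). Qed.

(** The condition [n <= #|T|] takes care of the default value of the minimum. *)
Lemma hamming_dist_set_ge v C n : n <= #|T| ->
  {in C, forall c, n <= hamming_dist v c} -> n <= hamming_dist_set v C.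
Proof. by move=> nT nC; exact: (@le_bigmin _ nat). Qed.

End Hamming.

(** * The quadric model of Omega and its polar form *)

Section Ree.

Local Open Scope ring_scope.

Variables (m : nat) (F : finFieldType).
Hypothesis cardF : #|F| = (3 ^ (2 * m + 1))%N.

Local Notation l := (3 ^ m.+1)%N.
Local Notation G := (Ree cardF).

Definition ree_vec (p : ree_point m F) : nat -> F :=
  nth 0 (if val p is Some (a, b, c, x, y, z)
         then [:: 1; a; b; c; x; y; z] else [:: 0; 0; 0; 0; 0; 0; 1]).

Definition ree_form (p r : ree_point m F) : F := polar7 (ree_vec p) (ree_vec r).

Let three0 : 3 = 0 :> F.
Proof. exact: pcharf0 (ree_pchar cardF). Qed.

Lemma exprlD (a b : F) : (a + b) ^+ l = a ^+ l + b ^+ l.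
Proof.
by rewrite exprDn_pchar ?pnatX ?(pnatE _ (isT : prime 3)) ?(ree_pchar cardF).
Qed.

Lemma exprlN (a : F) : (- a) ^+ l = - a ^+ l.
Proof.
by apply/eqP; rewrite -addr_eq0 -exprlD addNr expr0n expn_eq0.
Qed.

Lemma exprll (a : F) : (a ^+ l) ^+ l = a ^+ 3.
Proof.
rewrite -exprM (_ : l * l = 3 ^ (2 * m + 1) * 3)%N.
  by rewrite exprM -cardF finfield.expf_card.
by rewrite -expnD -expnSr addSn addnS addnn -mul2n addn1.
Qed.

Lemma ree_form_t (al be ga : F) p r :
  ree_form (ree_t_fun al be ga p) (ree_t_fun al be ga r) = ree_form p r.
Proof.
have z k : (3 * k)%N%:R = 0 :> F by rewrite natrM three0 mul0r.
have nz k : - (3 * k)%N%:R = 0 :> F by rewrite z oppr0.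
elim/ree_pointP: p => [|a b c]; elim/ree_pointP: r => [|a' b' c'] //;
  rewrite /ree_form /polar7 /ree_vec /=;
  try by rewrite ?(mul0r, mulr0, add0r, addr0).
rewrite /ree_lambda1 /ree_lambda2 /ree_lambda3.
rewrite !(mulnC 2) !(exprD, exprM) !expr1.
rewrite ?(exprlD, exprlN, exprMn, exprll).
(* Only [l]-th powers of variables remain, and they can be made independent: the goal is a
   polynomial identity modulo 3. *)
move: (a ^+ l) (b ^+ l) (c ^+ l) (a' ^+ l) (b' ^+ l) (c' ^+ l)
  (al ^+ l) (be ^+ l) (ga ^+ l) => A B C A' B' C' Al Be Ga.
(* The [ring] tactic has integer coefficients: the hypotheses kill exactly the
   multiples of 3 which occur in the normal form of the difference. *)
apply/eqP; rewrite -subr_eq0; apply/eqP.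
by ring: (z 1) (z 2) (z 3) (z 4) (nz 1) (nz 2) (nz 3).
Qed.

Lemma ree_quad_vec p : quad7 (ree_vec p) = 0.
Proof.
elim/ree_pointP: p => [|a b c]; rewrite /quad7 /ree_vec /=.
  by rewrite !(mul0r, expr0n, addr0).
rewrite /ree_lambda1 /ree_lambda2 /ree_lambda3.
rewrite !(mulnC 2) !(exprD, exprM) !expr1.
move: (a ^+ l) (b ^+ l) (c ^+ l) => A B C.
by ring: three0.
Qed.

Lemma ree_form_infty p : p != ree_infty m F -> ree_form (ree_infty m F) p = 1.
Proof.
elim/ree_pointP: p => [|a b c _]; first by rewrite eqxx.
by rewrite /ree_form /polar7 /ree_vec /= !(mul0r, mulr0, add0r, addr0) mulr1.
Qed.

Lemma ree_formC p r : ree_form p r = ree_form r p.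
Proof. by rewrite /ree_form /polar7; ring. Qed.

Lemma ree_form_diag p : ree_form p p = 0.
Proof.
transitivity (2 * quad7 (ree_vec p)); last by rewrite ree_quad_vec mulr0.
by rewrite /ree_form /polar7 /quad7; ring.
Qed.

Lemma ree_form_origin a b c :
  ree_form (ree_affine m 0 0 0) (ree_affine m a b c) = ree_lambda3 m a b c.
Proof.
have l0 : (l == 0)%N = false by rewrite expn_eq0.
rewrite /ree_form /polar7 /ree_vec /= /ree_lambda1 /ree_lambda2 /ree_lambda3.
rewrite !(mulnC 2) !(exprD, exprM) !expr1 !expr0n l0 /= mulr0n.
by move: (a ^+ l) (b ^+ l) (c ^+ l) => *; ring.
Qed.

Lemma ree_t_from_origin al be ga :
  ree_t_fun al be ga (ree_affine m (0 : F) 0 0) = ree_affine m al be ga.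
Proof. by rewrite /ree_t_fun /= !(mulr0, add0r, subr0, addr0). Qed.

Lemma ree_t_infty al be ga :
  ree_t_fun al be ga (ree_infty m F) = ree_infty m F.
Proof. by []. Qed.

(** A translation moves an affine [p] to the origin, where the form is [ree_lambda3], which vanishes
    only at the origin. *)
Lemma ree_form_neq0 p r : p != r -> ree_form p r != 0.
Proof.
elim/ree_pointP: p => [|a b c].
  by rewrite eq_sym => /ree_form_infty->; rewrite oner_eq0.
rewrite -ree_t_from_origin -[r](permKV (ree_t m a b c)) permE ree_form_t.
move: (_ r) => {}r; rewrite (inj_eq (@ree_t_inj _ _ _ _ _)).
elim/ree_pointP: r => [|a' b' c'].
  by rewrite ree_formC => /ree_form_infty->; rewrite oner_eq0.
rewrite ree_form_origin (ree_lambda3_eq0 cardF); apply: contra.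
by case/and3P=> /eqP-> /eqP-> /eqP->.
Qed.

(** The lambdas are polynomials over the prime field, so they commute with the Frobenius map. *)
Lemma ree_vec_h p i : ree_vec (ree_h_fun p) i = ree_vec p i ^+ 3.
Proof.
have cubeD (x y : F) : (x + y) ^+ 3 = x ^+ 3 + y ^+ 3 by ring: three0.
have cubeN (x : F) : (- x) ^+ 3 = - x ^+ 3 by ring.
elim/ree_pointP: p => [|a b c]; rewrite /ree_vec /ree_h_fun /=.
  do 7?[case: i => [|i] //=; rewrite ?expr0n ?expr1n //].
  by rewrite nth_nil expr0n.
do 7?[case: i => [|i] //=; rewrite ?expr1n //]; last by rewrite nth_nil expr0n.
all: rewrite /ree_lambda1 /ree_lambda2 /ree_lambda3.
all: rewrite ?(mulnC 2) ?(exprD, exprM) ?expr1.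
all: rewrite ![(_ ^+ 3) ^+ l]exprAC !(cubeD, cubeN, exprMn); ring.
Qed.

Lemma ree_form_h p r :
  ree_form (ree_h_fun p) (ree_h_fun r) = ree_form p r ^+ 3.
Proof.
have cubeD (x y : F) : (x + y) ^+ 3 = x ^+ 3 + y ^+ 3 by ring: three0.
(* The coefficient 2 of [polar7] is fixed by cubing, as 8 - 3 * 2 = 2. *)
have E8 : 2 ^+ 3 = 2 :> F.
  by rewrite -[LHS]subr0 -[in LHS](mul0r 2) -three0; ring.
rewrite /ree_form /polar7 !ree_vec_h !cubeD !exprMn E8; ring.
Qed.

(** * Elements of the Ree group as similitudes *)

Definition ree_similitude (mu : ree_point m F -> F)
    (g : {perm ree_point m F}) :=
  (forall p, mu p != 0) /\
  (forall p r, ree_form (g p) (g r) = mu p * mu r * ree_form p r).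

Lemma ree_similitude_t al be ga : ree_similitude (fun=> 1) (ree_t m al be ga).
Proof.
by split=> [p|p r]; rewrite ?oner_eq0 // !permE ree_form_t !mul1r.
Qed.

(** The diagonal matrix with weights 0, 1, l+1, l+2, l+3, 2l+3, 2l+4 in [k] multiplies B by
    k^(2l+4), which splits evenly between two affine points. At infinity the inverse factor is
    forced, because B(infty, p) = 1 for every affine p. *)
Lemma ree_similitude_n (k : {unit F}) :
  ree_similitude
    (fun p => if p == ree_infty m F then val k ^- (l + 2) else val k ^+ (l + 2))
    (ree_n m k).
Proof.
have k0 : val k != 0 := unit_neq0_subproof k.
split=> [p|p r]; first by case: ifP; rewrite ?invr_eq0 expf_neq0.
rewrite !permE; move: (val k) k0 => {}k k0.
wlog: p r / p != ree_infty m F.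
  move=> IH; have /orP[/eqP->|/IH//] := orbN (p == ree_infty m F).
  have /orP[/eqP->|/IH IHr] := orbN (r == ree_infty m F).
    by rewrite !ree_form_diag mulr0.
  by rewrite ree_formC IHr (ree_formC r) [_ * (if r == _ then _ else _)]mulrC.
move=> p0; rewrite (negPf p0); elim/ree_pointP: p p0 => [|a b c _].
  by rewrite eqxx.
elim/ree_pointP: r => [|a' b' c'].
  rewrite !(ree_formC _ (ree_infty m F)) eqxx !ree_form_infty //.
  by rewrite divff ?expf_neq0 // mulr1.
rewrite /= /ree_form /polar7 /ree_vec /=.
rewrite /ree_lambda1 /ree_lambda2 /ree_lambda3.
rewrite !(mulnC 2) !(exprD, exprM) !expr1.
rewrite ?(exprMn, exprll); move: (k ^+ l).
by move: (a ^+ l) (b ^+ l) (c ^+ l) (a' ^+ l) (b' ^+ l) (c' ^+ l) => *; ring.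
Qed.

Lemma ree_vec_w a b c i : (i < 7)%N -> ree_lambda3 m a b c != 0 ->
  ree_vec (ree_w_fun (ree_affine m a b c)) i =
    (ree_lambda3 m a b c)^-1 * ree_vec (ree_affine m a b c) (6 - i).
Proof.
move=> i7 l30; rewrite /ree_w_fun /= -(ree_lambda3_eq0 cardF) (negPf l30).
have [e1 e2 e3] := ree_w_coords cardF l30.
rewrite /ree_vec /= e1 e2 e3.
by do 7![case: i i7 => [|i] i7 /=; first by rewrite ?mulVf // mulrC].
Qed.

(** B is invariant under reversing the coordinates, and [mu] only renormalizes the vectors. The
    origin and infinity, which [w] swaps, need no scaling and are treated apart. *)
Lemma ree_similitude_w :
  ree_similitude
    (fun p => if val p is Some (a, b, c, _, _, _) then
       if [&& a == 0, b == 0 & c == 0] then 1 else (ree_lambda3 m a b c)^-1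
     else 1)
    (ree_w cardF).
Proof.
set mu := fun p => _.
have mu_infty : mu (ree_infty m F) = 1 by [].
have mu_o : mu (ree_affine m (0 : F) 0 0) = 1 by rewrite /mu /= eqxx.
have mu_neq0 p : mu p != 0.
  elim/ree_pointP: p => [|a b c]; first by rewrite oner_eq0.
  by rewrite /mu /= -(ree_lambda3_eq0 cardF); case: ifP => [_|/negbT nz];
    rewrite ?oner_eq0 ?invr_eq0.
have w_infty : ree_w_fun (ree_infty m F) = ree_affine m 0 0 0 by [].
have w_o : ree_w_fun (ree_affine m (0 : F) 0 0) = ree_infty m F.
  by rewrite /ree_w_fun /= eqxx.
have ho r : ree_form (ree_w_fun (ree_infty m F)) (ree_w_fun r) =
    mu (ree_infty m F) * mu r * ree_form (ree_infty m F) r.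
  elim/ree_pointP: r => [|a b c]; first by rewrite !ree_form_diag mulr0.
  rewrite mu_infty ree_form_infty // mul1r mulr1 w_infty.
  rewrite /mu /=; case: ifP => [/and3P[/eqP-> /eqP-> /eqP->]|nz].
    by rewrite w_o ree_formC ree_form_infty.
  have l30 : ree_lambda3 m a b c != 0 by rewrite (ree_lambda3_eq0 cardF) nz.
  rewrite /ree_w_fun /= nz ree_form_origin.
  by have [_ _ ->] := ree_w_coords cardF l30; rewrite mul1r.
have h1 r : ree_form (ree_w_fun (ree_affine m (0 : F) 0 0)) (ree_w_fun r) =
    mu (ree_affine m 0 0 0) * mu r * ree_form (ree_affine m 0 0 0) r.
  elim/ree_pointP: r => [|a b c].
    by rewrite ree_formC ho (ree_formC (ree_infty _ _)) (mulrC (mu _)).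
  rewrite mu_o w_o ree_form_origin mul1r.
  rewrite /mu /=; case: ifP => [/and3P[/eqP-> /eqP-> /eqP->]|nz].
    by rewrite w_o ree_form_diag mul1r -ree_form_origin ree_form_diag.
  have l30 : ree_lambda3 m a b c != 0 by rewrite (ree_lambda3_eq0 cardF) nz.
  by rewrite mulVf // ree_form_infty // /ree_w_fun /= nz.
split=> // p r; rewrite !permE.
elim/ree_pointP: p => [|a b c]; first exact: ho.
elim/ree_pointP: r => [|a' b' c'].
  by rewrite ree_formC ho (ree_formC (ree_infty _ _)) (mulrC (mu _)).
case nz : [&& a == 0, b == 0 & c == 0].
  by case/and3P: nz => /eqP-> /eqP-> /eqP->; exact: h1.
case nz' : [&& a' == 0, b' == 0 & c' == 0].
  case/and3P: nz' => /eqP-> /eqP-> /eqP->.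
  by rewrite ree_formC h1 (ree_formC (ree_affine _ 0 0 0)) (mulrC (mu _)).
rewrite /mu /= nz nz' /ree_form /polar7.
rewrite !ree_vec_w ?(ree_lambda3_eq0 cardF) ?nz ?nz' //.
by rewrite !(subSS, subn0); ring.
Qed.

Lemma ree_similitudeP g : g \in G -> exists mu, ree_similitude mu g.
Proof.
(* The similitudes form a group, so it is enough to check the generators; finite functions make the
   existence of [mu] decidable. *)
pose A : {set {perm ree_point m F}} :=
  [set f : {perm ree_point m F} |
    [exists mu : {ffun ree_point m F -> F}, [forall p, mu p != 0] &&
    [forall p, forall r, ree_form (f p) (f r) == mu p * mu r * ree_form p r]]].
have AP (f : {perm ree_point m F}) :
    reflect (exists mu, ree_similitude mu f) (f \in A).
  rewrite inE; apply: (iffP existsP) => -[mu].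
    case/andP=> /forallP mu0 /forallP muE; exists mu; split=> // p r.
    exact/eqP/(forallP (muE p)).
  case=> mu0 muE; exists [ffun p => mu p]; apply/andP; split.
    by apply/forallP => p; rewrite ffunE.
  by apply/forallP => p; apply/forallP => r; rewrite !ffunE muE.
have gA : group_set A.
  apply/group_setP; split=> [|f1 f2 /AP[mu1 [mu10 E1]] /AP[mu2 [mu20 E2]]].
    by apply/AP; exists (fun=> 1); split=> [p|p r];
      rewrite ?oner_eq0 // !perm1 !mul1r.
  (* Factors compose as a cocycle, [f1] being applied first. *)
  apply/AP; exists (fun p => mu1 p * mu2 (f1 p)).
  split=> [p|p r]; first by rewrite mulf_neq0.
  by rewrite !permM E2 E1; ring.
suff /subsetP sGA : G \subset Group gA by move/sGA/AP.
rewrite gen_subG !subUset sub1set -andbA; apply/and3P; split.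
- apply/subsetP => _ /imsetP[[[al be] ga] _ ->]; apply/AP.
  by exists (fun=> 1); apply: ree_similitude_t.
- apply/subsetP => _ /imsetP[k _ ->]; apply/AP.
  by eexists; apply: ree_similitude_n.
- by apply/AP; eexists; apply: ree_similitude_w.
Qed.

(** * Points where [h] agrees with a group element *)

Lemma card_ree_h_agree g :
  g \in G -> (#|[set p | ree_h cardF p == g p]| <= 28)%N.
Proof.
case/ree_similitudeP=> mu [mu0 muE].
apply: (@card_partial_ovoid F _ _ (@ree_vec) mu) => [p _|p _|p r] //.
  exact: ree_quad_vec.
rewrite !inE => /eqP hp /eqP hr pr.
apply: (mulIf (ree_form_neq0 pr)); rewrite -muE -hp -hr !permE ree_form_h.
by rewrite -exprSr.
Qed.

Lemma card_ree_h_fix :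
  (28 <= #|[set p | ree_h cardF p == (1 : {perm _})%g p]|)%N.
Proof.
(* [P] is the prime field, fixed pointwise by cubing. *)
pose P : {set F} := [set 0; 1; -1].
have P3 x : x \in P -> x ^+ 3 = x.
  by rewrite !inE -orbA => /or3P[] /eqP ->; rewrite ?expr0n ?expr1n //; ring.
have cP : #|P| = 3%N.
  have m1 : (1 == -1 :> F) = false.
    apply/negbTE; rewrite -subr_eq0 opprK; apply/eqP => E.
    have : 3 = (1 + 1) + 1 :> F by ring.
    by rewrite three0 E add0r => /esym/eqP; rewrite oner_eq0.
  rewrite /P -setUA cardsU1 !inE cards2 m1.
  by rewrite [0 == 1]eq_sym oner_eq0 [0 == -1]eq_sym oppr_eq0 oner_eq0.
pose f (x : F * F * F) := ree_affine m x.1.1 x.1.2 x.2.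
have fI : injective f.
  by move=> [[a b] c] [[a' b'] c'] /ree_affine_inj /= [-> -> ->].
have <- : #|ree_infty m F |: f @: setX (setX P P) P| = 28%N.
  rewrite cardsU1 card_imset // !cardsX cP.
  by case: imsetP => // -[x _].
apply: subset_leq_card; rewrite subUset sub1set inE perm1 permE eqxx /=.
apply/subsetP => _ /imsetP[[[a b] c] + ->].
rewrite !inE /= => /andP[/andP[aP bP] cP'].
by rewrite perm1 permE /ree_h_fun /= !P3 ?inE.
Qed.

(** * Two-transitivity *)

Lemma ree_t_in al be ga : ree_t m al be ga \in G.
Proof.
apply/mem_gen/setUP; left; apply/setUP; left.
by apply/imsetP; exists (al, be, ga).
Qed.

Lemma ree_w_in : ree_w cardF \in G.
Proof. by apply/mem_gen/setUP; right; rewrite inE. Qed.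

(** [w] followed by a translation takes infinity to any affine point, and the translations, which
    fix infinity, are transitive on affine points. *)
Lemma ree_2transitive (p r : ree_point m F) : p != r ->
  exists2 g, g \in G &
    g (ree_infty m F) = p /\ g (ree_affine m (0 : F) 0 0) = r.
Proof.
move=> pr.
have [g gG gp] : exists2 g, g \in G & g (ree_infty m F) = p.
  elim/ree_pointP: p pr => [|a b c] _; first by exists 1%g; rewrite ?perm1.
  exists (ree_w cardF * ree_t m a b c)%g.
    by rewrite groupM ?ree_w_in ?ree_t_in.
  by rewrite permM !permE ree_t_from_origin.
(* The preimage of [r] under [g] is affine, as [g] sends infinity to [p]. *)
move: (permKV g r); elim/ree_pointP: ((g^-1)%g r) => [|a b c] gr.
  by rewrite -gp gr eqxx in pr.
exists (ree_t m a b c * g)%g; first by rewrite groupM ?ree_t_in.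
by rewrite !permM !permE ree_t_infty ree_t_from_origin.
Qed.

End Ree.

Theorem theorem1p4 (m : nat) (F : finFieldType)
    (cardF : #|F| = 3 ^ (2 * m + 1)) :
  let q := 3 ^ (2 * m + 1) in
  (q ^ 3 - 27 <= covering_radius (Ree cardF) <= q ^ 3 - 1) /\
  hamming_dist_set (ree_h cardF) (Ree cardF) = q ^ 3 - 27.
Proof.
move=> q.
have cardT : #|{: ree_point m F}| = q ^ 3 + 1 by rewrite card_ree_point cardF.
have dh : hamming_dist_set (ree_h cardF) (Ree cardF) = q ^ 3 - 27.
  apply/eqP; rewrite eqn_leq; apply/andP; split.
    (* The identity attains the minimum: it agrees with [h] in at least 28 of the q^3 + 1 points. *)
    apply: leq_trans (hamming_dist_set_le _ (group1 _)) _.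
    rewrite hamming_distE cardT -(subnDr 1 _ 27) leq_sub2l //.
    exact: card_ree_h_fix.
  apply: hamming_dist_set_ge => [|g gG].
    by rewrite cardT; apply: leq_trans (leq_subr _ _) (leq_addr _ _).
  by rewrite hamming_distE cardT -(subnDr 1 _ 27) leq_sub2l // card_ree_h_agree.
split=> //; apply/andP; split.
  rewrite -dh.
  exact: (leq_bigmax (F := fun v => hamming_dist_set v (Ree cardF))).
apply/bigmax_leqP => v _.
(* Some [g] in the group agrees with [v] at infinity and at the origin, hence the distance is at
   most q^3 + 1 - 2. *)
have [|g gG [g1 g2]] := ree_2transitive cardF
    (p := v (ree_infty m F)) (r := v (ree_affine m (0 : F) 0 0)%R).
  by rewrite (inj_eq perm_inj).
apply: leq_trans (hamming_dist_set_le _ gG) _.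
rewrite hamming_distE cardT -(subnDr 1 _ 1) leq_sub2l //.
have <- : #|[set ree_infty m F; ree_affine m (0 : F)%R 0%R 0%R]| = 1 + 1.
  by rewrite cards2.
by apply: subset_leq_card; rewrite subUset !sub1set !inE g1 g2 !eqxx.
Qed.
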